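(* Consider a homogeneous fixed-step first-order scheme in the normalized case $L=1$, together with a horizon extension from $n$ to $n+1$ that retains the old queries and adds exactly one new terminal query, labelled by one new oracle direction (see context). At horizon $n$, suppose the formal trajectory under prescribed unit oracle vectors $v_0,\ldots,v_{m-1}$ of a Euclidean space has the representation, with query labels $\ell(i)\in\{0,\ldots,m-1\}$ for $0\le i\le n$, $$x_{0,n}=\sum_{j=0}^{m-1}(w_n)_jv_j,\qquad x_{i,n}=v_{\ell(i)}+z_{i,n},\qquad z_{i,n}=\sum_{j=0}^{m-1}(d_{i,n})_jv_j\qquad(0\le i\le n),$$ where $w_n,d_{i,n}\in\mathbb{R}^m$. Set $c_n=d_{n,n}$, $C_n=\mathbf{1}^\top c_n$, $D_{i,n}=\mathbf{1}^\top d_{i,n}$, $A_n=\mathbf{1}^\top w_n$. Let $G_n$ be the Gram matrix of $v_0,\dots,v_{m-1}$. Assume: (i) for every $0\le i\leq n$ and every $0\le j<m$, $\langle z_{i,n},v_{\ell(i)}-v_j\rangle\geq 0$ and $\langle z_{i,n},v_{\ell(i)}\rangle\geq 0$; (ii) $z_{n,n}=0$, $C_n>0$, and $D_{i,n}\geq C_n$ for every $0\le i\leq n$; (iii) for some $\theta_n\in(0,C_n)$ and $\rho_n>0$, the coefficient table of the scheme at horizon $n+1$ is $$w_{n+1}=(w_n,\theta_n),\qquad d_{i,n+1}=(d_{i,n},\theta_n)\ (0\le i\leq n),\qquad d_{n+1,n+1}=\rho_n(c_n,\theta_n),$$ with the old labels unchanged and $\ell(n+1)=m$. Let $s_n=\theta_n/C_n$,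 $a_n=\sqrt{1-s_n^2}$, choose a unit vector $e\perp\operatorname{span}\{v_0,\dots,v_{m-1}\}$, and set $$v_j^+=a_nv_j+s_ne\quad(0\le j<m),\qquad v_m^+=-e.$$ Let $x_{0,n+1}=\sum_{j=0}^m (w_{n+1})_jv_j^+$, $z_{i,n+1}=\sum_{j=0}^m(d_{i,n+1})_jv_j^+$ and $x_{i,n+1}=v^+_{\ell(i)}+z_{i,n+1}$ for $0\le i\le n+1$ be the formal trajectory at horizon $n+1$ under $v_0^+,\dots,v_m^+$. Then: (a) $v_0^+,\ldots,v_m^+$ are unit vectors; for all $0\le i\le n+1$ and $0\le j\le m$, $\langle z_{i,n+1},v^+_{\ell(i)}-v^+_j\rangle\ge 0$ and $\langle z_{i,n+1},v^+_{\ell(i)}\rangle\ge 0$; and $z_{n+1,n+1}=0$. (b) If $\ker G_n=\operatorname{span}\{c_n\}$, then the Gram matrix of $v_0^+,\dots,v_m^+$ is $$G_{n+1}=\begin{pmatrix}(1-s_n^2)G_n+s_n^2\mathbf{1}\mathbf{1}^\top&-s_n\mathbf{1}\\-s_n\mathbf{1}^\top&1\end{pmatrix},$$ with $\ker G_{n+1}=\operatorname{span}\{d_{n+1,n+1}\}$ and $\operatorname{rank}G_{n+1}=\operatorname{rank}G_n+1$. (c) Writing $\mathcal{R}_n=\lVert x_{0,n}\rVert^2$ and $\mathcal{R}_{n+1}=\lVert x_{0,n+1}\rVert^2$, $$\mathcal{R}_{n+1}=(1-s_n^2)\mathcal{R}_n+(s_nA_n-\theta_n)^2.$$ (d) Let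 $K_{n+1}=\operatorname{conv}\{0,v_0^+,\ldots,v_m^+\}$. Then $\phi_{K_{n+1}}$ is a global convex function with $1$-Lipschitz gradient, minimized at $0$, satisfying $\nabla\phi_{K_{n+1}}(x_{i,n+1})=v^+_{\ell(i)}$ for $0\le i\le n+1$, so that the formal trajectory is the actual trajectory of the scheme on $\phi_{K_{n+1}}$. When $\mathcal{R}_{n+1}>0$, set $\alpha=\mathcal{R}_{n+1}^{-1/2}$, $\widetilde K_{n+1}=\alpha K_{n+1}$ and $\widetilde x_{i,n+1}=\alpha x_{i,n+1}$; this scaled instance has $\lVert\widetilde x_{0,n+1}\rVert=1$ and $$\min_{0\leq i\leq n+1}\lVert\nabla\phi_{\widetilde K_{n+1}}(\widetilde x_{i,n+1})\rVert^2=\frac1{\mathcal{R}_{n+1}}.$$ (e) Consequently (when $\mathcal{R}_{n+1}>0$), if in an ambient space $\mathbb{R}^D$ containing an isometric copy of the vectors $v_0^+,\dots,v_m^+$ (that is, $m+1$ vectors of $\mathbb{R}^D$ with the same Gram matrix as $v_0^+,\dots,v_m^+$), the number $1/\mathcal{R}_{n+1}$ is an upper bound for $$\sup\Bigl\{\min_{0\le i\le n+1}\lVert\nabla f(x_i)\rVert^2:\ f\in\mathcal{F}_{0,1}(\mathbb{R}^D),\ x_\star\in\arg\min f,\ \lVert x_0-x_\star\rVert\le 1\Bigr\},$$ where $x_0,\dots,x_{n+1}$ are the query points of the same scheme at horizon $n+1$, then this supremum equals $1/\mathcal{R}_{n+1}$.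
   Context: $\mathbf{1}$ denotes the all-ones vector of the appropriate length; $(w,\theta)$ denotes the vector $w$ with one extra last coordinate $\theta$. $\mathcal{F}_{0,1}(\mathbb{R}^D)$ is the class of convex differentiable functions on $\mathbb{R}^D$ with $1$-Lipschitz gradient (Euclidean norm). For a nonempty compact convex set $K$ containing the origin, $\phi_K(x):=\max_{g\in K}\{\langle x,g\rangle-\tfrac12\lVert g\rVert^2\}$. A fixed-step first-order scheme at horizon $n$ produces query points $x_0,\dots,x_n$ from a starting point $x_0$ and the oracle (gradient) vectors $g_0,\dots,g_n$ returned at those points, by fixed linear equations in which $x_i$ depends only on $x_0$ and $g_0,\dots,g_{i-1}$. It is homogeneous: a common positive scaling of all points and prescribed oracle vectors preserves these linear trajectory equations. The formal trajectory under prescribed oracle vectors with labels $\ell$ is the sequence of points produced by these equations when the oracle vector at query $i$ is declared to be the prescribed vector with label $\ell(i)$. The coefficient table $(w_n,(d_{i,n})_{i\le n})$ with labels $\ell$ records this trajectory formally, as coefficients with respect to the prescribed oracle vectors: starting from the combination of the oracle vectors with coefficients $w_n$ and using the oracle vector labelled $\ell(i)$ at query $i$, the scheme's equations yield as $i$-th query point the oracle vector labelled $\ell(i)$ plus the combination with coefficients $d_{i,n}$. The same convention applies at horizon $n+1$. The horizon extension keeps the query equations for indices $0,\dots,n$ and adds one query with index $n+1$. *)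

(* Defs.v *)
From HB Require Import structures.
From mathcomp Require Import all_boot all_order all_algebra.
From mathcomp Require Import all_classical all_reals.
From mathcomp Require Import interval_inference convex topology ereal normedtype derive.

Set Implicit Arguments.
Unset Strict Implicit.
Unset Printing Implicit Defensive.

Import Order.TTheory GRing.Theory Num.Theory.
Import numFieldNormedType.Exports.

Local Open Scope classical_set_scope.
Local Open Scope ring_scope.

Section Euclidean.
Context {R : realType}.

Definition dot {N : nat} (u v : 'rV[R]_N) : R := \sum_(i < N) u 0 i * v 0 i.

(* The library norm `|u| on 'rV[R]_N is the sup norm, hence this separate
   definition; both induce the same topology and the same differentials. *)
Definition enorm {N : nat} (u : 'rV[R]_N) : R := Num.sqrt (dot u u).

Definition gram {m N : nat} (v : 'I_m -> 'rV[R]_N) : 'M[R]_m :=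
  \matrix_(i, j) dot (v i) (v j).

Definition lincomb {m N : nat} (c : 'rV[R]_m) (v : 'I_m -> 'rV[R]_N) : 'rV[R]_N :=
  \sum_(j < m) c 0 j *: v j.

(* 1^T c *)
Definition coord_sum {m : nat} (c : 'rV[R]_m) : R := \sum_(j < m) c 0 j.

Definition conv_hull {N : nat} (A : set 'rV[R]_N) : set 'rV[R]_N :=
  smallest (fun B : set 'rV[R]_N => convex_set B) A.

(* Meaningful where f is differentiable. *)
Definition grad {D : nat} (f : 'rV[R]_D -> R) (x : 'rV[R]_D) : 'rV[R]_D :=
  \row_(i < D) 'D_(delta_mx 0 i) f x.

Definition F01 {D : nat} (f : 'rV[R]_D -> R) : Prop :=
  [/\ convex_function [set: 'rV[R]_D] f,
      forall x, differentiable f x &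
      forall x y, enorm (grad f x - grad f y) <= enorm (x - y)].

Definition argmin {D : nat} (f : 'rV[R]_D -> R) (x : 'rV[R]_D) : Prop :=
  forall y, f x <= f y.

(* For nonempty compact K the supremum is attained: see [phi_max]. *)
Definition phi {N : nat} (K : set 'rV[R]_N) (x : 'rV[R]_N) : R :=
  sup [set dot x g - 2^-1 * enorm g ^+ 2 | g in K].

Definition min_sqgrad {D n : nat} (f : 'rV[R]_D -> R)
    (x : 'I_n.+1 -> 'rV[R]_D) : R :=
  \big[Num.min/enorm (grad f (x ord0)) ^+ 2]_(i < n.+1) enorm (grad f (x i)) ^+ 2.

Lemma dot_ge0 {N : nat} (u : 'rV[R]_N) : 0 <= dot u u.
Proof. by apply: sumr_ge0 => i _; rewrite -expr2 sqr_ge0. Qed.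

Lemma phi_max {N : nat} (K : set 'rV[R]_N) (x : 'rV[R]_N) :
  compact K -> K !=set0 ->
  exists2 g, K g & phi K x = dot x g - 2^-1 * enorm g ^+ 2 /\
    forall h, K h -> dot x h - 2^-1 * enorm h ^+ 2 <= phi K x.
Proof.
move=> cK K0; pose F (g : 'rV[R]_N) : R := dot x g - 2^-1 * enorm g ^+ 2.
have cdot (p q : 'rV[R]_N -> 'rV[R]_N) :
    continuous p -> continuous q -> continuous (fun g => dot (p g) (q g)).
  move=> cp cq; apply: continuous_big => [|i _ g]; first exact: add_continuous.
  have cc (r : 'rV[R]_N -> 'rV[R]_N) : continuous r -> continuous (fun h => r h 0 i).
    move=> cr h; apply: (@continuous_comp _ _ _ r (fun u : 'rV[R]_N => u 0 i)).
      exact: cr.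
    exact: coord_continuous.
  exact: (continuousM (cc p cp g) (cc q cq g)).
have cF : continuous F.
  have -> : F = (fun g => dot x g - 2^-1 * dot g g).
    by apply: funext => g; rewrite /F sqr_sqrtr ?dot_ge0.
  have cx := cdot _ _ (fun h => @cst_continuous _ _ x h) (fun h => @cvg_id _ (nbhs h)).
  have cg := cdot _ _ (fun h => @cvg_id _ (nbhs h)) (fun h => @cvg_id _ (nbhs h)).
  move=> g; apply: (@continuousB _ _ _ (dot x) (fun g => 2^-1 * dot g g)).
    exact: cx.
  apply: (@continuousM _ _ (fun=> 2^-1) (fun g => dot g g) g _ (cg g)).
  exact: cst_continuous.
have [g gK gmax] := EVT_max_rV K0 cK (continuous_subspaceT cF).
rewrite inE in gK.
have ubF : ubound [set F h | h in K] (F g).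
  by move=> _ [h hK <-]; apply: gmax; rewrite inE.
have phiE : phi K x = F g.
  apply/eqP; rewrite eq_le; apply/andP; split.
    by apply: ge_sup => //; exists (F g), g.
  by apply: ub_le_sup; [exists (F g)|exists g].
by exists g => //; split=> // h hK; rewrite phiE; apply: ubF; exists h.
Qed.

End Euclidean.

(* Horizon n: n+1 queries.  The i-th query is
     x_i = a_i x_0 + \sum_(k < i) h_(i,k) g_k,
   with a_0 = 1 so that query 0 is the starting point.  Only the entries
   h_(i,k) with k < i are ever used. *)
Record scheme (R : realType) (n : nat) := Scheme {
  start_coef : 'I_n.+1 -> R;
  step_coef : 'I_n.+1 -> 'I_n.+1 -> R;
  start_coef0 : start_coef ord0 = 1 }.

Section Scheme.
Context {R : realType}.

(* Stated in an arbitrary module, so as to apply both to actual vectors and to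
   rows of coefficients. *)
Definition query {n : nat} (S : scheme R n) {E : lmodType R} (x0 : E)
    (g : 'I_n.+1 -> E) (i : 'I_n.+1) : E :=
  start_coef S i *: x0 + \sum_(k < n.+1 | (k < i)%N) step_coef S i k *: g k.

Lemma query0 {n : nat} (S : scheme R n) {E : lmodType R} (x0 : E) g :
  query S x0 g ord0 = x0.
Proof. by rewrite /query start_coef0 scale1r big_pred0 ?addr0. Qed.

Lemma query_homogeneous {n : nat} (S : scheme R n) {E : lmodType R} (x0 : E) g
    (a : R) i :
  query S (a *: x0) (fun k => a *: g k) i = a *: query S x0 g i.
Proof.
rewrite /query scalerDr scaler_sumr !scalerA mulrC; congr (_ + _).
by apply: eq_bigr => k _; rewrite !scalerA mulrC.
Qed.

Definition old_query {n : nat} (i : 'I_n.+1) : 'I_n.+2 := widen_ord (leqnSn n.+1) i.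

Definition extends {n : nat} (S' : scheme R n.+1) (S : scheme R n) : Prop :=
  forall i : 'I_n.+1, start_coef S' (old_query i) = start_coef S i /\
    forall k : 'I_n.+1, (k < i)%N ->
      step_coef S' (old_query i) (old_query k) = step_coef S i k.

(* (w, d) is the coefficient table of S with labels l; the basis row
   delta_mx 0 j stands for the oracle vector with label j. *)
Definition has_table {n m : nat} (S : scheme R n) (l : 'I_n.+1 -> 'I_m)
    (w : 'rV[R]_m) (d : 'I_n.+1 -> 'rV[R]_m) : Prop :=
  forall i, query S w (fun k => delta_mx 0 (l k)) i = delta_mx 0 (l i) + d i.

Definition is_run {n D : nat} (S : scheme R n) (f : 'rV[R]_D -> R)
    (x0 : 'rV[R]_D) (x : 'I_n.+1 -> 'rV[R]_D) : Prop :=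
  forall i, x i = query S x0 (fun k => grad f (x k)) i.

Definition worst_case {n : nat} (S : scheme R n) (D : nat) : \bar R :=
  ereal_sup [set r | exists (f : 'rV[R]_D -> R) (xstar : 'rV[R]_D)
                       (x : 'I_n.+1 -> 'rV[R]_D),
    [/\ F01 f, argmin f xstar, enorm (x ord0 - xstar) <= 1,
        is_run S f (x ord0) x & r = (min_sqgrad f x)%:E]].

(* v_j^+ = a v_j + s e for j < m, and v_m^+ = - e. *)
Definition lift_vectors {m N : nat} (a s : R) (v : 'I_m -> 'rV[R]_N)
    (e : 'rV[R]_N) (j : 'I_(m + 1)) : 'rV[R]_N :=
  match fintype.split j with
  | inl j' => a *: v j' + s *: e
  | inr _ => - e
  end.

End Scheme.

(* Main.v *)
Require Import Defs.
From HB Require Import structures.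
From mathcomp Require Import all_boot all_order all_algebra.
From mathcomp Require Import all_classical all_reals.
From mathcomp Require Import interval_inference convex topology ereal normedtype landau derive.
From mathcomp Require Import ring lra.

(** For a compact convex K containing the origin, phi_K is the convex conjugate
    of the half squared norm restricted to K, that is, the half squared norm
    minus half the squared distance to K.  Hence its gradient at x is the
    Euclidean projection of x on K, which is nonexpansive, and phi_K is
    minimal at 0.  So a formal trajectory is the run of the scheme on phi_K as
    soon as the i-th query point v_(l i) + z_i projects on v_(l i).  By the
    variational characterization of the projection, this says that z_i lies in
    the normal cone of K at v_(l i); for K the hull of 0 and the v_j it is
    enough to test the vertices, which gives exactly the inequalities
    <z_i, v_(l i) - v_j> >= 0 and <z_i, v_(l i)> >= 0 ([hull0_proj],
    [grad_phi], [formal_run]).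

    It remains to see that the lift preserves these inequalities.  By
    [lincomb_lift], a combination of the lifted vectors with coefficients
    (y, t) is a (sum_j y_j v_j) + (s 1^T y - t) e.  Applied to the rows of the
    new table this gives z_i^+ = a z_i + (s D_i - theta) e, where
    s D_i - theta = s (D_i - C) >= 0, while the choice s = theta / C makes the
    component on e of the new terminal displacement vanish.  The orthogonality
    of e then yields (a) and (c), and shows that (y, t) is a linear relation
    between the lifted vectors exactly when y is one between the old vectors
    and t = s 1^T y, which is (b).

    Rescaling all vectors by alpha keeps the table and the inequalities, since
    both are homogeneous, so the normalized instance in (d) is an instance of
    the same construction ([normalized_instance]).  All the hypotheses of the
    construction are inner products of combinations of the vectors, hence
    depend on the Gram matrix only: the hard instance exists in any space
    containing an isometric copy, which gives the lower bound in (e)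
    ([worst_case_ge]). *)

Set Implicit Arguments.
Unset Strict Implicit.
Unset Printing Implicit Defensive.

Import Order.TTheory GRing.Theory Num.Theory.
Import numFieldNormedType.Exports.

Local Open Scope classical_set_scope.
Local Open Scope ring_scope.

(** * The Euclidean inner product *)

Section Dot.
Context {R : realType} {N : nat}.
Implicit Types (u v w x y : 'rV[R]_N) (a : R).

Lemma dot_mulmx u v : dot u v = (u *m v^T) 0 0.
Proof. by rewrite mxE; apply: eq_bigr => i _; rewrite mxE. Qed.

Lemma dotC u v : dot u v = dot v u.
Proof. by apply: eq_bigr => i _; rewrite mulrC. Qed.

Lemma dotDl u v w : dot (u + v) w = dot u w + dot v w.
Proof. by rewrite !dot_mulmx mulmxDl mxE. Qed.

Lemma dotZl a u v : dot (a *: u) v = a * dot u v.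
Proof. by rewrite !dot_mulmx -scalemxAl mxE. Qed.

Lemma dotDr u v w : dot w (u + v) = dot w u + dot w v.
Proof. by rewrite dotC dotDl !(dotC w). Qed.

Lemma dotZr a u v : dot v (a *: u) = a * dot v u.
Proof. by rewrite dotC dotZl (dotC v). Qed.

Lemma dotNl u v : dot (- u) v = - dot u v.
Proof. by rewrite -scaleN1r dotZl mulN1r. Qed.

Lemma dotNr u v : dot v (- u) = - dot v u.
Proof. by rewrite dotC dotNl (dotC v). Qed.

Lemma dot0l u : dot 0 u = 0.
Proof. by rewrite -(scale0r 0) dotZl mul0r. Qed.

Definition dot_lin := (dotDl, dotDr, dotNl, dotNr, dotZl, dotZr).

Lemma dot_eq0 u : dot u u = 0 -> u = 0.
Proof.
move=> /eqP; rewrite psumr_eq0 => [|i _]; last by rewrite -expr2 sqr_ge0.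
move=> /allP u0; apply/rowP => i; rewrite mxE.
by have /= := u0 i (mem_index_enum i); rewrite mulf_eq0 orbb => /eqP.
Qed.

Lemma enorm_sqr u : enorm u ^+ 2 = dot u u.
Proof. by rewrite sqr_sqrtr ?dot_ge0. Qed.

Lemma enorm_le u v : (enorm u <= enorm v) = (dot u u <= dot v v).
Proof. by rewrite ler_sqrt ?dot_ge0. Qed.

(** The topology of row vectors comes from the sup norm; this comparison turns
    Euclidean error bounds into little-o statements for that norm. *)
Lemma dot_le_norm u : dot u u <= N%:R * `|u| ^+ 2.
Proof.
have -> : N%:R * `|u| ^+ 2 = \sum_(i < N) `|u| ^+ 2.
  by rewrite sumr_const card_ord mulr_natl.
apply: ler_sum => i _; rewrite -expr2 -real_normK ?num_real //.
rewrite lerXn2r ?nnegrE //.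
rewrite [leRHS]/Num.norm /= mx_normrE.
by apply: (le_bigmax _ (fun k => `|u k.1 k.2|) (ord0, i)).
Qed.

Lemma dot_linear u : linear (dot u : 'rV[R]_N -> R^o).
Proof. by move=> a v w; rewrite dotDr dotZr. Qed.

HB.instance Definition _ u :=
  GRing.isLinear.Build R 'rV[R]_N R^o _ (dot u) (dot_linear u).

Lemma dot_continuous u : continuous (dot u).
Proof.
apply: continuous_big => [|i _ g]; first exact: add_continuous.
apply: continuousM; first exact: cst_continuous.
exact: coord_continuous.
Qed.

End Dot.

(** * Projections and the gradient of phi *)

Section Projection.
Context {R : realType} {N : nat}.
Implicit Types (K : set 'rV[R]_N) (g h p q x y : 'rV[R]_N).

Lemma convex_setP K : convex_set K <->
  forall x y t, K x -> K y -> 0 <= t -> t <= 1 -> K (t *: x + (1 - t) *: y).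
Proof.
split=> [cK x y t Kx Ky t0 t1|cK x y t]; last first.
  by rewrite !inE => Kx Ky; apply: cK.
have := cK x y (Itv01 t0 t1); rewrite !inE; exact.
Qed.

(** The obtuse angle criterion: for convex K it says that g is the point of K
    nearest to x. *)
Definition is_proj K x g := K g /\ forall h, K h -> 0 <= dot (x - g) (g - h).

(** The right side exceeds the left by <x - g, g - h> + |g - h|^2 / 2. *)
Lemma is_proj_optimal K x g h : is_proj K x g -> K h ->
  dot x h - 2^-1 * dot h h <= dot x g - 2^-1 * dot g g.
Proof.
move=> [_ xg] Kh; have := xg h Kh; have := dot_ge0 (g - h).
by rewrite !dot_lin (dotC h g); lra.
Qed.

Lemma is_proj_phi K x g : is_proj K x g ->
  phi K x = dot x g - 2^-1 * dot g g.
Proof.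
move=> xg; have Kg := xg.1.
apply/eqP; rewrite eq_le; apply/andP; split.
  apply: ge_sup; first by exists (dot x g - 2^-1 * enorm g ^+ 2), g.
  by move=> _ [h Kh <-]; rewrite enorm_sqr (is_proj_optimal xg).
rewrite -enorm_sqr; apply: ub_le_sup; last by exists g.
exists (dot x g - 2^-1 * dot g g) => _ [h Kh <-].
by rewrite enorm_sqr (is_proj_optimal xg).
Qed.

Lemma phi_ge K x g : compact K -> K g ->
  dot x g - 2^-1 * dot g g <= phi K x.
Proof.
move=> cK Kg; have [|_ _ [_ max]] := phi_max x cK; first by exists g.
by rewrite -enorm_sqr max.
Qed.

(** The maximizer g in the definition of phi is a projection: moving from g
    towards h in K changes the objective by t <x - g, h - g> - t^2 |h - g|^2 / 2,
    which would be positive for small t if <x - g, h - g> were. *)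
Lemma exists_proj K x : compact K -> convex_set K -> K !=set0 ->
  exists g, is_proj K x g.
Proof.
move=> cK /convex_setP convK K0; have [g Kg [phiE gmax]] := phi_max x cK K0.
exists g; split=> // h Kh; rewrite leNgt; apply/negP => lt0.
set b := dot (x - g) (h - g); set q := dot (h - g) (h - g).
have b0 : 0 < b by rewrite /b -(opprB g h) dotNr oppr_gt0.
have q0 : 0 <= q := dot_ge0 _.
have bq0 : 0 < b + q by rewrite ltr_wpDr.
(* At the step t = b / (b + q) the first-order gain t b exceeds t^2 q / 2. *)
set t := b / (b + q).
have t0 : 0 < t by rewrite divr_gt0.
have t1 : t <= 1 by rewrite ler_pdivrMr // mul1r lerDl.
have := gmax _ (convK _ _ t Kh Kg (ltW t0) t1).
rewrite phiE !enorm_sqr.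
have -> : t *: h + (1 - t) *: g = g + t *: (h - g).
  by rewrite scalerBl scale1r scalerBr addrCA addrA.
have tbq : t * (b + q) = b by rewrite divfK // gt_eqF.
move=> le; have {le} : t * b <= t * (2^-1 * (t * q)).
  move: le; rewrite /b /q !dot_lin (dotC h g); lra.
rewrite ler_pM2l //; nra.
Qed.

(** Each of p and q is tested as a competitor in the criterion of the other. *)
Lemma is_proj_nonexpansive K x y p q : is_proj K x p -> is_proj K y q ->
  dot (p - q) (p - q) <= dot (x - y) (p - q).
Proof.
move=> [Kp xp] [Kq yq]; have := xp _ Kq; have := yq _ Kp.
rewrite !dot_lin (dotC q p); lra.
Qed.

(** From |p - q|^2 <= <x - y, p - q> and |(x - y) - (p - q)|^2 >= 0. *)
Lemma is_proj_enorm_le K x y p q : is_proj K x p -> is_proj K y q ->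
  enorm (p - q) <= enorm (x - y).
Proof.
move=> xp yq; rewrite enorm_le.
have := is_proj_nonexpansive xp yq; have := dot_ge0 ((x - y) - (p - q)).
move: (x - y) (p - q) => u v; rewrite !dot_lin (dotC v u); lra.
Qed.

(** Both bounds come from using the maximizer at one point as a competitor at
    the other.  The upper one is <y - x, q - p>, and nonexpansiveness makes it
    quadratic in y - x: this is why phi is differentiable with gradient p. *)
Lemma phi_increment K x y p q : compact K -> is_proj K x p -> is_proj K y q ->
  0 <= phi K y - phi K x - dot (y - x) p <= dot (y - x) (y - x).
Proof.
move=> cK xp yq; have Kp := xp.1; have Kq := yq.1.
rewrite (is_proj_phi xp); apply/andP; split.
  have := phi_ge y cK Kp; rewrite !dot_lin; lra.
have := phi_ge x cK Kq; rewrite (is_proj_phi yq) (is_proj_phi xp).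
have := is_proj_nonexpansive xp yq; have := dot_ge0 ((x - y) - (p - q)).
by rewrite !dot_lin (dotC q p) (dotC p x) (dotC q x) (dotC p y) (dotC q y) (dotC y x); lra.
Qed.

Section Gradient.
Variable K : set 'rV[R]_N.
Hypotheses (cK : compact K) (convK : convex_set K) (K0 : K !=set0).

Lemma phi_expansion x p : is_proj K x p ->
  (phi K : 'rV[R]_N -> R^o) \o shift x =
    cst (phi K x : R^o) + (dot p : 'rV[R]_N -> R^o) +o_ (0 : 'rV[R]_N) id.
Proof.
move=> xp; apply/eqaddoP => _/posnumP[eps].
(* The error is at most N |h|^2, hence at most eps |h| once |h| <= eps / (N + 1);
   the + 1 covers N = 0. *)
have c0 : 0 < eps%:num / (N.+1%:R : R) by rewrite divr_gt0.
near=> h.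
have [q yq] := exists_proj (h + x) cK convK K0.
have := phi_increment cK xp yq; rewrite addrK => /andP[lo hi].
have hsmall : `|h| <= eps%:num / N.+1%:R.
  by near: h; exact: (@nbhs0_le _ 'rV[R]_N _ c0).
rewrite -[X in `|X| <= _]/(phi K (h + x) - (phi K x + dot p h)).
rewrite opprD addrA (dotC p) ger0_norm //.
apply: le_trans hi (le_trans (dot_le_norm h) _).
rewrite expr2 mulrA ler_wpM2r //.
apply: le_trans (_ : N.+1%:R * `|h| <= _).
  by rewrite ler_wpM2r // ler_nat.
by rewrite mulrC -ler_pdivlMr.
Unshelve. all: by end_near. Qed.

Lemma phi_is_diff x p : is_proj K x p ->
  differentiable (phi K) x /\ 'd (phi K) x = dot p :> ('rV[R]_N -> R).
Proof.
move=> xp; have exp := phi_expansion xp.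
have dE := diff_unique (@dot_continuous _ _ p) exp.
split=> //; apply/diff_locallyP; rewrite dE; split=> //.
exact: dot_continuous.
Qed.

Lemma grad_phi x p : is_proj K x p -> grad (phi K) x = p.
Proof.
move=> xp; have [df dE] := phi_is_diff xp.
apply/rowP => i; rewrite mxE deriveE // dE /dot (bigD1 i) //= big1 => [|j ji].
  by rewrite mxE !eqxx mulr1 addr0.
by rewrite mxE (negPf ji) andbF mulr0.
Qed.

(** Convexity holds because phi is a supremum of affine functions; the
    Lipschitz bound is the nonexpansiveness of the projection. *)
Lemma phi_F01 : F01 (phi K).
Proof.
split=> [t x y _ _|x|x y].
- have [g Kg [phiE _]] := phi_max (conv t x y) cK K0.
  rewrite phiE enorm_sqr [leRHS]convRE.
  have := phi_ge x cK Kg; have := phi_ge y cK Kg.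
  have t0 : 0 <= t%:num by [].
  have t1 : 0 <= 1 - t%:num by rewrite subr_ge0 le1.
  move=> /(ler_wpM2l t1) ly /(ler_wpM2l t0) lx.
  apply: le_trans (lerD lx ly); rewrite /conv /= !dot_lin /unstable.onem; lra.
- have [p xp] := exists_proj x cK convK K0.
  by have [] := phi_is_diff xp.
- have [p xp] := exists_proj x cK convK K0.
  have [q yq] := exists_proj y cK convK K0.
  by rewrite (grad_phi xp) (grad_phi yq) (is_proj_enorm_le xp yq).
Qed.

(** phi 0 <= 0, while the competitor 0 gives phi >= 0 everywhere. *)
Lemma phi_argmin : K 0 -> argmin (phi K) 0.
Proof.
move=> Kz y; have [g Kg [-> _]] := phi_max 0 cK K0.
apply: le_trans (phi_ge y cK Kz).
have := sqr_ge0 (enorm g); rewrite dot0l dotC !dot0l; lra.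
Qed.

End Gradient.
End Projection.

(** * Linear combinations, Gram matrices and coefficient tables *)

Section Lincomb.
Context {R : realType}.

Lemma lincomb_mulmx {m N : nat} (c : 'rV[R]_m) (v : 'I_m -> 'rV[R]_N) :
  lincomb c v = mulmxr (\matrix_j v j) c.
Proof.
by rewrite /= mulmx_sum_row; apply: eq_bigr => j _; rewrite rowK.
Qed.

Lemma lincombZl {m N : nat} a (c : 'rV[R]_m) (v : 'I_m -> 'rV[R]_N) :
  lincomb (a *: c) v = a *: lincomb c v.
Proof. by rewrite !lincomb_mulmx linearZ. Qed.

Lemma lincombZr {m N : nat} a (c : 'rV[R]_m) (v : 'I_m -> 'rV[R]_N) :
  lincomb c (fun j => a *: v j) = a *: lincomb c v.
Proof.
by rewrite /lincomb scaler_sumr; apply: eq_bigr => j _; rewrite !scalerA mulrC.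
Qed.

Lemma lincomb_delta {m N : nat} j (v : 'I_m -> 'rV[R]_N) :
  lincomb (delta_mx 0 j) v = v j.
Proof. by rewrite lincomb_mulmx /= -rowE rowK. Qed.

Lemma lincombB {m N : nat} (b c : 'rV[R]_m) (v : 'I_m -> 'rV[R]_N) :
  lincomb (b - c) v = lincomb b v - lincomb c v.
Proof. by rewrite !lincomb_mulmx linearB. Qed.

Lemma dot_lincombr {m N : nat} (c : 'rV[R]_m) (v : 'I_m -> 'rV[R]_N) x :
  dot x (lincomb c v) = \sum_j c 0 j * dot x (v j).
Proof. by rewrite /lincomb linear_sum; apply: eq_bigr => j _; rewrite linearZ. Qed.

Lemma coord_sumZ {m : nat} a (c : 'rV[R]_m) :
  coord_sum (a *: c) = a * coord_sum c.
Proof. by rewrite /coord_sum mulr_sumr; apply: eq_bigr => j _; rewrite mxE. Qed.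

Lemma gram_mulmx {m N : nat} (v : 'I_m -> 'rV[R]_N) :
  gram v = (\matrix_j v j) *m (\matrix_j v j)^T.
Proof.
apply/matrixP => i j; rewrite !mxE; apply: eq_bigr => k _.
by rewrite !mxE.
Qed.

(** Inner products of combinations depend on the vectors only through their
    Gram matrix, so they transfer to any isometric copy. *)
Lemma dot_lincomb {m N : nat} (b c : 'rV[R]_m) (v : 'I_m -> 'rV[R]_N) :
  dot (lincomb b v) (lincomb c v) = (b *m gram v *m c^T) 0 0.
Proof.
by rewrite dot_mulmx !lincomb_mulmx /= gram_mulmx trmx_mul !mulmxA.
Qed.

(** A Gram matrix is positive semidefinite, so its kernel consists of the linear
    relations between the vectors. *)
Lemma lincomb_eq0 {m N : nat} (c : 'rV[R]_m) (v : 'I_m -> 'rV[R]_N) :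
  (c <= kermx (gram v))%MS = (lincomb c v == 0).
Proof.
apply/sub_kermxP/eqP => [cG|]; last first.
  by rewrite lincomb_mulmx gram_mulmx /= mulmxA => ->; rewrite mul0mx.
by apply: dot_eq0; rewrite dot_lincomb cG mul0mx mxE.
Qed.

Lemma query_linear {n : nat} (S : scheme R n) {E F : lmodType R}
    (f : {linear E -> F}) (x0 : E) g i :
  f (query S x0 g i) = query S (f x0) (fun k => f (g k)) i.
Proof.
rewrite /query linearD linearZ linear_sum; congr (_ + _).
by apply: eq_bigr => k _; rewrite linearZ.
Qed.

(** The table is a formal run whose oracle vectors are basis rows; the linear
    map sending these rows to the v_j turns it into a run with oracle vectors
    v_j. *)
Lemma has_table_query {n m N : nat} (S : scheme R n) l w d
    (v : 'I_m -> 'rV[R]_N) i : has_table S l w d ->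
  query S (lincomb w v) (fun k => v (l k)) i = v (l i) + lincomb (d i) v.
Proof.
move=> /(_ i) tab; rewrite -[v (l i)](lincomb_delta (l i)) !lincomb_mulmx.
rewrite -linearD -tab query_linear; congr (query S _ _ i).
by apply: funext => k; rewrite -[LHS](lincomb_delta (l k)) lincomb_mulmx.
Qed.

End Lincomb.

(** * The convex hull of the origin and finitely many vectors *)

Section Hull.
Context {R : realType}.

(** Since the origin is among the generators of the hull, the missing weight
    1 - coord_sum c can be left implicit. *)
Definition subsimplex (p : nat) : set 'rV[R]_p :=
  [set c : 'rV[R]_p | (forall j, 0 <= c 0 j) /\ coord_sum c <= 1].

Definition hull0 {p N : nat} (v : 'I_p -> 'rV[R]_N) : set 'rV[R]_N :=
  conv_hull ([set 0] `|` range v).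

Lemma coord_sum_continuous {p : nat} :
  continuous (@coord_sum R p : 'rV[R]_p -> R).
Proof.
apply: continuous_big => [|j _]; first exact: add_continuous.
exact: coord_continuous.
Qed.

Lemma lincomb_continuous {p N : nat} (v : 'I_p -> 'rV[R]_N) :
  continuous (fun c => lincomb c v).
Proof.
apply: continuous_big => [|j _ c]; first exact: add_continuous.
apply: (@continuousZr_tmp).
exact: coord_continuous.
Qed.

Lemma subsimplex_compact p : compact (@subsimplex p).
Proof.
apply: (@subclosed_compact _ _ [set c : 'rV[R]_p | forall j, `[0, 1]%classic (c 0 j)]).
- apply: closedI; last first.
    have := preimage_closed (f := @coord_sum R p) _ (@closed_le R 1).
    by apply=> c _; exact: coord_sum_continuous.
  rewrite [X in closed X](_ : _ = \bigcap_(j in setT) [set c : 'rV[R]_p | 0 <= c 0 j]).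
    apply: closed_bigI => j _.
    have := preimage_closed (f := fun c : 'rV[R]_p => c 0 j) _ (@closed_ge R 0).
    by apply=> c _; exact: coord_continuous.
  by apply/seteqP; split=> c /= h j => [_|]; apply: h.
- by apply: (@rV_compact R p (fun=> `[0, 1]%classic)) => j; apply: segment_compact.
- move=> c [c0 c1] j /=; rewrite in_itv /= c0 /=; apply: le_trans c1.
  by rewrite /coord_sum (bigD1 j) //= lerDl sumr_ge0.
Qed.

(** The total weight r is a parameter so that the induction removes one
    vector, passes to total weight r - c_0, and renormalizes only by r. *)
Lemma convex_lincomb {N : nat} (B : set 'rV[R]_N) : convex_set B -> B 0 ->
  forall p (v : 'I_p -> 'rV[R]_N) (c : 'I_p -> R) (r : R),
  (forall j, B (v j)) -> (forall j, 0 <= c j) -> \sum_j c j <= r ->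
  exists2 b, B b & \sum_j c j *: v j = r *: b.
Proof.
move=> /convex_setP convB B0; elim=> [|p IH] v c r Bv c0.
  by rewrite !big_ord0 => _; exists 0 => //; rewrite scaler0.
rewrite !big_ord_recl => cr.
have [b Bb ->] : exists2 b, B b &
    \sum_(j < p) c (lift ord0 j) *: v (lift ord0 j) = (r - c ord0) *: b.
  by apply: IH => // ; lra.
have rest0 : 0 <= \sum_(j < p) c (lift ord0 j) by apply: sumr_ge0.
have r0 : c ord0 <= r by lra.
have [rz|rnz] := eqVneq r 0.
  have cz : c ord0 = 0 by have := c0 ord0; lra.
  by exists 0 => //; rewrite rz cz subrr !scale0r addr0.
have rp : 0 < r by rewrite lt_neqAle eq_sym rnz (le_trans (c0 ord0)).
exists (c ord0 / r *: v ord0 + (1 - c ord0 / r) *: b).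
  by apply: convB; rewrite ?divr_ge0 ?ler_pdivrMr ?mul1r // ltW.
by rewrite scalerDr !scalerA mulrBr mulr1 [r * _]mulrC divfK.
Qed.

(** The hull is thus a continuous image of a compact set, and vectors of the
    hull have explicit coordinates. *)
Lemma hull0E {p N : nat} (v : 'I_p -> 'rV[R]_N) :
  hull0 v = [set lincomb c v | c in @subsimplex p].
Proof.
apply/seteqP; split.
  apply: smallest_sub.
    apply/convex_setP => _ _ t [b [b0 b1] <-] [c [c0 c1] <-] t0 t1.
    exists (t *: b + (1 - t) *: c).
      split=> [j|]; first by rewrite !mxE addr_ge0 // mulr_ge0 // subr_ge0.
      have -> : coord_sum (t *: b + (1 - t) *: c) =
          t * coord_sum b + (1 - t) * coord_sum c.
        rewrite /coord_sum !mulr_sumr -big_split /=.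
        by apply: eq_bigr => j _; rewrite !mxE.
      by nra.
    by rewrite !lincomb_mulmx linearP linearZ.
  move=> x [->|[j _ <-]].
    exists 0; last by rewrite lincomb_mulmx linear0.
    split=> [j|]; first by rewrite mxE.
    by rewrite /coord_sum big1 // => j _; rewrite mxE.
  exists (delta_mx 0 j); last exact: lincomb_delta.
  split=> [k|]; first by rewrite mxE ler0n.
  rewrite /coord_sum (bigD1 j) //= big1 => [|k kj]; first by rewrite mxE !eqxx addr0.
  by rewrite mxE (negPf kj) andbF.
move=> _ [c [c0 c1] <-] B [convB subB].
have [||b Bb E] := convex_lincomb convB _ (v := v) _ c0 c1.
- by apply: subB; left.
- by move=> j; apply: subB; right; exists j.
by rewrite /lincomb E scale1r.
Qed.

Lemma hull0_compact {p N : nat} (v : 'I_p -> 'rV[R]_N) : compact (hull0 v).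
Proof.
rewrite hull0E; apply: continuous_compact; last exact: subsimplex_compact.
by apply: continuous_subspaceT; apply: lincomb_continuous.
Qed.

Lemma hull0_convex {p N : nat} (v : 'I_p -> 'rV[R]_N) : convex_set (hull0 v).
Proof.
apply/convex_setP => x y t Kx Ky t0 t1 B [convB subB].
by apply: (proj1 (convex_setP B)) => //; [apply: Kx|apply: Ky].
Qed.

Lemma hull0_0 {p N : nat} (v : 'I_p -> 'rV[R]_N) : hull0 v 0.
Proof. by apply: sub_gen_smallest; left. Qed.

Lemma hull0_vertex {p N : nat} (v : 'I_p -> 'rV[R]_N) j : hull0 v (v j).
Proof. by apply: sub_gen_smallest; right; exists j. Qed.

Lemma hull0_scale {p N : nat} a (v : 'I_p -> 'rV[R]_N) :
  [set a *: g | g in hull0 v] = hull0 (fun j => a *: v j).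
Proof.
rewrite !hull0E; apply/seteqP; split=> [_ [_ [c Sc <-] <-]|_ [c Sc <-]].
  by exists c => //; rewrite lincombZr.
by exists (lincomb c v); [exists c|rewrite lincombZr].
Qed.

(** For h = sum_j c_j v_j, <z, h> = sum_j c_j <z, v_j> is at most
    (sum_j c_j) <z, v_i>, and this is at most <z, v_i> because sum_j c_j <= 1
    and <z, v_i> >= 0.  The last inequality is the test against the vertex 0. *)
Lemma hull0_proj {p N : nat} (v : 'I_p -> 'rV[R]_N) i z :
  (forall j, 0 <= dot z (v i - v j)) -> 0 <= dot z (v i) ->
  is_proj (hull0 v) (v i + z) (v i).
Proof.
move=> zB z0; split; first exact: hull0_vertex.
rewrite hull0E => _ [c [c0 c1] <-]; rewrite addrC addKr.
rewrite dotDr dotNr subr_ge0 dot_lincombr.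
apply: le_trans (_ : coord_sum c * dot z (v i) <= _); last first.
  by rewrite ler_piMl.
rewrite /coord_sum mulr_suml; apply: ler_sum => j _; apply: ler_wpM2l => //.
by have := zB j; rewrite dotDr dotNr subr_ge0.
Qed.

Lemma hull0_phi_F01 {p N : nat} (v : 'I_p -> 'rV[R]_N) : F01 (phi (hull0 v)).
Proof.
apply: phi_F01; [exact: hull0_compact|exact: hull0_convex|].
by exists 0; apply: hull0_0.
Qed.

Lemma hull0_phi_argmin {p N : nat} (v : 'I_p -> 'rV[R]_N) : argmin (phi (hull0 v)) 0.
Proof.
apply: phi_argmin; [exact: hull0_compact| |exact: hull0_0].
by exists 0; apply: hull0_0.
Qed.

End Hull.

(** * Formal trajectories as runs on phi *)

Section Trajectory.
Context {R : realType} {n p N : nat}.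
Variables (S : scheme R n) (l : 'I_n.+1 -> 'I_p).
Variables (w : 'rV[R]_p) (d : 'I_n.+1 -> 'rV[R]_p) (v : 'I_p -> 'rV[R]_N).
Hypothesis tab : has_table S l w d.
Hypothesis zB : forall i j, 0 <= dot (lincomb (d i) v) (v (l i) - v j).
Hypothesis z0 : forall i, 0 <= dot (lincomb (d i) v) (v (l i)).

Lemma formal_grad i :
  grad (phi (hull0 v)) (v (l i) + lincomb (d i) v) = v (l i).
Proof.
apply: grad_phi; [exact: hull0_compact|exact: hull0_convex| |].
  by exists 0; apply: hull0_0.
exact: hull0_proj.
Qed.

Lemma formal_run : is_run S (phi (hull0 v)) (lincomb w v)
  (fun i => v (l i) + lincomb (d i) v).
Proof.
move=> i; rewrite -(has_table_query v i tab); congr (query S _ _ i).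
by apply: funext => k; rewrite formal_grad.
Qed.

End Trajectory.

Lemma min_sqgrad_const {R : realType} {D n : nat} (f : 'rV[R]_D -> R)
    (x : 'I_n.+1 -> 'rV[R]_D) r :
  (forall i, enorm (grad f (x i)) ^+ 2 = r) -> min_sqgrad f x = r.
Proof.
move=> fr; rewrite /min_sqgrad fr.
by elim/big_rec: _ => // i y _ ->; rewrite fr minxx.
Qed.

Section Scaled.
Context {R : realType} {n p N : nat}.
Variables (S : scheme R n) (l : 'I_n.+1 -> 'I_p).
Variables (w : 'rV[R]_p) (d : 'I_n.+1 -> 'rV[R]_p) (v : 'I_p -> 'rV[R]_N).
Hypothesis tab : has_table S l w d.
Hypothesis v1 : forall j, enorm (v j) = 1.
Hypothesis zB : forall i j, 0 <= dot (lincomb (d i) v) (v (l i) - v j).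
Hypothesis z0 : forall i, 0 <= dot (lincomb (d i) v) (v (l i)).
Let x i := v (l i) + lincomb (d i) v.
Let x0 := lincomb w v.
Let r := enorm x0 ^+ 2.
Let alpha := (Num.sqrt r)^-1.
Hypothesis r0 : 0 < r.

(** Scaling by alpha replaces the vectors v_j by alpha v_j in the same table and
    multiplies the required inner products by alpha^2. *)
Lemma normalized_instance :
  let Kt := [set alpha *: g | g in hull0 v] in
  [/\ F01 (phi Kt), argmin (phi Kt) 0,
      is_run S (phi Kt) (alpha *: x0) (fun i => alpha *: x i),
      enorm (alpha *: x0) = 1 &
      min_sqgrad (phi Kt) (fun i => alpha *: x i) = 1 / r].
Proof.
move=> Kt; have a0 : 0 <= alpha by rewrite invr_ge0 sqrtr_ge0.
have aa : alpha * alpha = r^-1.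
  by rewrite -expr2 exprVn sqr_sqrtr // ltW.
rewrite /Kt hull0_scale; set u := fun j => alpha *: v j.
have uB i j : 0 <= dot (lincomb (d i) u) (u (l i) - u j).
  by rewrite lincombZr -scalerBr dotZl dotZr !mulr_ge0.
have u0 i : 0 <= dot (lincomb (d i) u) (u (l i)).
  by rewrite lincombZr dotZl dotZr !mulr_ge0.
have -> : (fun i => alpha *: x i) = (fun i => u (l i) + lincomb (d i) u).
  by apply: funext => i; rewrite lincombZr scalerDr.
rewrite -[alpha *: x0]lincombZr -/u; split.
- exact: hull0_phi_F01.
- exact: hull0_phi_argmin.
- exact: formal_run.
- rewrite lincombZr /enorm dotZl dotZr mulrA aa -enorm_sqr.
  by rewrite mulVf ?sqrtr1 // gt_eqF.
- apply: min_sqgrad_const => i; rewrite formal_grad //.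
  by rewrite enorm_sqr dotZl dotZr mulrA aa -enorm_sqr v1 expr1n mulr1 div1r.
Qed.

(** The normalized instance, with minimizer 0, is a competitor in the supremum. *)
Lemma worst_case_ge : ((1 / r)%:E <= worst_case S N)%E.
Proof.
have := normalized_instance; cbv zeta; case=> fF fmin run nx minE.
apply: ereal_sup_ubound; set f := phi _ in fF fmin run minE.
exists f, 0, (fun i => alpha *: x i).
have x00 : alpha *: x ord0 = alpha *: x0 by rewrite run query0.
by split; rewrite ?x00 ?subr0 ?nx ?minE.
Qed.

End Scaled.

(** * The lift by one orthogonal direction *)

Section Lift.
Context {R : realType} {m N : nat}.
Variables (v : 'I_m -> 'rV[R]_N) (e : 'rV[R]_N) (a s : R).
Local Notation v' := (lift_vectors a s v e).

Lemma lift_lshift j : v' (lshift 1 j) = a *: v j + s *: e.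
Proof. by rewrite /lift_vectors (unsplitK (inl j)). Qed.

Lemma lift_rshift k : v' (rshift m k) = - e.
Proof. by rewrite /lift_vectors (unsplitK (inr k)). Qed.

Lemma lincomb_lift (y : 'rV[R]_m) t :
  lincomb (row_mx y t%:M) v' = a *: lincomb y v + (s * coord_sum y - t) *: e.
Proof.
rewrite /lincomb big_split_ord /= big_ord1 row_mxEr lift_rshift mxE eqxx mulr1n.
rewrite scalerN scalerBl addrA; congr (_ - _).
rewrite /coord_sum mulr_sumr scaler_suml scaler_sumr -big_split /=.
apply: eq_bigr => j _.
by rewrite row_mxEl lift_lshift scalerDr !scalerA (mulrC a) (mulrC s).
Qed.

Hypothesis e1 : enorm e = 1.
Hypothesis ev : forall j, dot e (v j) = 0.

Lemma dot_ee : dot e e = 1.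
Proof. by rewrite -enorm_sqr e1 expr1n. Qed.

Lemma dot_e_lincomb y : dot e (lincomb y v) = 0.
Proof. by rewrite dot_lincombr big1 // => j _; rewrite ev mulr0. Qed.

Lemma dot_lift x y q r : dot e x = 0 -> dot e y = 0 ->
  dot (a *: x + q *: e) (a *: y + r *: e) = a ^+ 2 * dot x y + q * r.
Proof.
by move=> ex ey; rewrite !dot_lin dot_ee (dotC x e) ex ey; ring.
Qed.

Hypothesis as1 : a ^+ 2 = 1 - s ^+ 2.
Hypothesis v1 : forall j, enorm (v j) = 1.

Lemma gram_lift : gram v' = block_mx
  ((1 - s ^+ 2) *: gram v + s ^+ 2 *: const_mx 1) (const_mx (- s))
  (const_mx (- s)) 1%:M.
Proof.
apply/matrixP => i j; rewrite [LHS]mxE.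
case: (split_ordP i) => i' ->; case: (split_ordP j) => j' ->.
- by rewrite block_mxEul !lift_lshift dot_lift // as1 !mxE mulr1 expr2.
- by rewrite block_mxEur lift_lshift lift_rshift !dot_lin dot_ee (dotC _ e) ev !mxE; ring.
- by rewrite block_mxEdl lift_lshift lift_rshift !dot_lin dot_ee ev !mxE; ring.
- by rewrite block_mxEdr !lift_rshift !dot_lin dot_ee !ord1 !mxE opprK.
Qed.

Lemma lift_unit j : enorm (v' j) = 1.
Proof.
rewrite /enorm; case: (split_ordP j) => j' ->.
  rewrite lift_lshift dot_lift // -[dot (v j') _]enorm_sqr v1 expr1n mulr1 as1.
  by rewrite -expr2 subrK sqrtr1.
by rewrite lift_rshift !dot_lin opprK dot_ee sqrtr1.
Qed.

Hypothesis a0 : a != 0.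

(** The component on e and the component orthogonal to e vanish separately. *)
Lemma lincomb_lift_eq0 y t : (lincomb (row_mx y t%:M) v' == 0) =
  (lincomb y v == 0) && (t == s * coord_sum y).
Proof.
rewrite lincomb_lift; apply/idP/andP => [/eqP E|[/eqP -> /eqP ->]]; last first.
  by rewrite subrr scale0r scaler0 addr0.
have ts : s * coord_sum y - t = 0.
  have := congr1 (dot e) E; rewrite !dot_lin dot_e_lincomb dot_ee (dotC e 0) dot0l.
  by rewrite mulr0 add0r mulr1.
move: E; rewrite ts scale0r addr0 => /eqP; rewrite scaler_eq0 (negPf a0) /= => ->.
by split=> //; rewrite eq_sym -subr_eq0 ts.
Qed.

(** By [lincomb_lift_eq0] a relation y between the v_j extends to the lifted
    vectors by the single last coordinate s 1^T y, which for y = c is theta. *)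
Lemma kermx_lift c theta rho : rho != 0 -> theta = s * coord_sum c ->
  (kermx (gram v) == c)%MS ->
  (kermx (gram v') == rho *: row_mx c theta%:M)%MS.
Proof.
move=> rho0 thE /eqmxP kerv; apply/rV_eqP => u; rewrite (eqmx_scale _ rho0).
have -> : u = row_mx (lsubmx u) (rsubmx u 0 0)%:M.
  by rewrite -mx11_scalar hsubmxK.
move: (lsubmx u) (rsubmx u 0 0) => y t.
rewrite lincomb_eq0 lincomb_lift_eq0 -lincomb_eq0 kerv.
apply/andP/idP => [[/sub_rVP[k ->] /eqP ->]|/sub_rVP[k]].
  apply/sub_rVP; exists k.
  by rewrite scale_row_mx scale_scalar_mx thE coord_sumZ mulrCA.
rewrite scale_row_mx scale_scalar_mx => /eq_row_mx[-> /matrixP /(_ 0 0)].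
rewrite !mxE !eqxx !mulr1n => ->; rewrite scalemx_sub //; split=> //.
by rewrite thE coord_sumZ mulrCA.
Qed.

End Lift.

Lemma rank_kermx_row {F : fieldType} {m : nat} (A : 'M[F]_m) (c : 'rV[F]_m) :
  c != 0 -> (kermx A == c)%MS -> (\rank A).+1 = m.
Proof.
move=> c0 /eqmx_rank; rewrite mxrank_ker rank_rV c0.
by move=> kdim; rewrite -[RHS](subnK (rank_leq_row A)) kdim add1n.
Qed.

Lemma query_index_cases {n : nat} (P : 'I_n.+2 -> Prop) :
  (forall i, P (old_query i)) -> P ord_max -> forall i, P i.
Proof.
move=> Pold Pnew i; case: (unliftP ord_max i) => [j ->|-> //].
have -> : lift ord_max j = old_query j by apply/val_inj; apply: lift_max.
exact: Pold.
Qed.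

(** * The horizon extension *)

Theorem proposition9p1 (R : realType) (n m N : nat)
    (S : scheme R n) (S' : scheme R n.+1)
    (l : 'I_n.+1 -> 'I_m) (w : 'rV[R]_m) (d : 'I_n.+1 -> 'rV[R]_m)
    (l' : 'I_n.+2 -> 'I_(m + 1)) (w' : 'rV[R]_(m + 1))
    (d' : 'I_n.+2 -> 'rV[R]_(m + 1))
    (theta rho : R) (v : 'I_m -> 'rV[R]_N) (e : 'rV[R]_N) :
  let c := d ord_max in
  let C := coord_sum c in
  let A := coord_sum w in
  let z i := lincomb (d i) v in
  let s := theta / C in
  let a := Num.sqrt (1 - s ^+ 2) in
  let v' := lift_vectors a s v e in
  let x0 := lincomb w v in
  let x0' := lincomb w' v' in
  let z' i := lincomb (d' i) v' in
  let x' i := v' (l' i) + z' i in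
  let Rn := enorm x0 ^+ 2 in
  let Rn' := enorm x0' ^+ 2 in
  let K' := conv_hull ([set 0] `|` range v') in
  let alpha := (Num.sqrt Rn')^-1 in
  let Kt := [set alpha *: g | g in K'] in
  let xt i := alpha *: x' i in
  extends S' S ->
  (forall j, enorm (v j) = 1) ->
  has_table S l w d ->
  (* (i) *)
  (forall i j, 0 <= dot (z i) (v (l i) - v j)) ->
  (forall i, 0 <= dot (z i) (v (l i))) ->
  (* (ii) *)
  z ord_max = 0 -> 0 < C -> (forall i, C <= coord_sum (d i)) ->
  (* (iii) *)
  0 < theta -> theta < C -> 0 < rho ->
  (forall i, l' (old_query i) = lshift 1 (l i)) ->
  l' ord_max = rshift m ord0 ->
  w' = row_mx w theta%:M ->
  (forall i, d' (old_query i) = row_mx (d i) theta%:M) ->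
  d' ord_max = rho *: row_mx c theta%:M ->
  has_table S' l' w' d' ->
  (* the new direction *)
  enorm e = 1 -> (forall j, dot e (v j) = 0) ->
  [/\ (* (a) *)
      [/\ forall j, enorm (v' j) = 1,
          forall i j, 0 <= dot (z' i) (v' (l' i) - v' j),
          forall i, 0 <= dot (z' i) (v' (l' i)) &
          z' ord_max = 0],
      (* (b) *)
      (kermx (gram v) == c)%MS ->
      [/\ gram v' = block_mx
            ((1 - s ^+ 2) *: gram v + s ^+ 2 *: const_mx 1) (const_mx (- s))
            (const_mx (- s))                                1%:M,
          (kermx (gram v') == d' ord_max)%MS &
          \rank (gram v') = (\rank (gram v)).+1],
      (* (c) *)
      Rn' = (1 - s ^+ 2) * Rn + (s * A - theta) ^+ 2,
      (* (d) *)
      [/\ F01 (phi K'),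
          argmin (phi K') 0,
          forall i, grad (phi K') (x' i) = v' (l' i),
          is_run S' (phi K') x0' x' &
          0 < Rn' ->
          [/\ F01 (phi Kt), argmin (phi Kt) 0, is_run S' (phi Kt) (alpha *: x0') xt,
              enorm (alpha *: x0') = 1 &
              min_sqgrad (phi Kt) xt = 1 / Rn']] &
      (* (e) *)
      0 < Rn' ->
      forall (D : nat) (u : 'I_(m + 1) -> 'rV[R]_D), gram u = gram v' ->
        (worst_case S' D <= (1 / Rn')%:E)%E ->
        worst_case S' D = (1 / Rn')%:E].
Proof.
move=> c C A z s a v' x0 x0' z' x' Rn Rn' K' alpha Kt xt.
move=> _ v1 _ zB z0 zn0 C0 DC th0 thC rho0 lold lnew wE dold dnew tab e1 ev.
have Cn0 : C != 0 by rewrite gt_eqF.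
have s0 : 0 < s by rewrite divr_gt0.
have s1 : s < 1 by rewrite ltr_pdivrMr // mul1r.
have sC : theta = s * C by rewrite divfK.
have as0 : 0 < 1 - s ^+ 2 by rewrite subr_gt0 expr_lt1 // ltW.
have as1 : a ^+ 2 = 1 - s ^+ 2 by rewrite sqr_sqrtr // ltW.
have a0 : a != 0 by rewrite gt_eqF // sqrtr_gt0.
have z'old i : z' (old_query i) = a *: z i + (s * coord_sum (d i) - theta) *: e.
  by rewrite /z' dold lincomb_lift.
have z'new : z' ord_max = 0.
  rewrite /z' dnew lincombZl lincomb_lift -/(z ord_max) zn0 -/C -sC subrr.
  by rewrite scale0r scaler0 addr0 scaler0.
have ez i : dot e (z i) = 0 by apply: dot_e_lincomb.
(* s D_i - theta = s (D_i - C). *)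
have D0 i : 0 <= s * coord_sum (d i) - theta.
  by rewrite subr_ge0 sC ler_pM2l.
have zv' i : 0 <= dot (z' i) (v' (l' i)).
  move: i; apply: query_index_cases => [i|]; last by rewrite z'new dot0l.
  rewrite z'old lold /v' lift_lshift dot_lift //.
  by apply: addr_ge0; apply: mulr_ge0; rewrite ?sqr_ge0 ?(ltW s0).
have zB' i j : 0 <= dot (z' i) (v' (l' i) - v' j).
  move: i; apply: query_index_cases => [i|]; last by rewrite z'new dot0l.
  (* Against -e the extra term <z_i^+, e> is s D_i - theta. *)
  case: (split_ordP j) => k ->; last first.
    rewrite /v' lift_rshift opprK dotDr addr_ge0 //.
    rewrite z'old !dot_lin (dotC _ e) ez dot_ee // mulr0 add0r mulr1.
    exact: D0.
  rewrite z'old lold /v' !lift_lshift.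
  (* The components s e cancel between two lifted old vectors. *)
  have -> : a *: v (l i) + s *: e - (a *: v k + s *: e) =
      a *: (v (l i) - v k) + 0 *: e.
    by rewrite scale0r addr0 scalerBr opprD addrACA subrr addr0.
  rewrite dot_lift //; last by rewrite dotDr dotNr !ev subr0.
  by rewrite mulr0 addr0 mulr_ge0 ?sqr_ge0 ?zB.
have v'1 : forall j, enorm (v' j) = 1 by apply: lift_unit.
have c0 : c != 0.
  apply: contraTneq C0 => cz; rewrite /C cz /coord_sum big1 ?ltxx // => j _.
  by rewrite mxE.
split.
- by split.
- move=> ker.
  have d0 : d' ord_max != 0.
    by rewrite dnew scaler_eq0 (gt_eqF rho0) row_mx_eq0 (negPf c0).
  have ker' : (kermx (gram v') == d' ord_max)%MS.
    by rewrite dnew; apply: kermx_lift => //; rewrite gt_eqF.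
  split; [exact: gram_lift|exact: ker'|].
  by apply: succn_inj; rewrite (rank_kermx_row c0 ker) (rank_kermx_row d0 ker') addn1.
- have ex0 : dot e x0 = 0 by apply: dot_e_lincomb.
  by rewrite /Rn' /x0' /Rn wE lincomb_lift !enorm_sqr dot_lift // as1 expr2.
- split.
  + exact: hull0_phi_F01.
  + exact: hull0_phi_argmin.
  + by move=> i; apply: formal_grad.
  + exact: formal_run.
  + by move=> Rn'0; apply: normalized_instance.
- move=> Rn'0 D u gu ub; apply/eqP; rewrite eq_le ub /=.
  have dotu b b' : dot (lincomb b u) (lincomb b' u) =
      dot (lincomb b v') (lincomb b' v') by rewrite !dot_lincomb gu.
  (* The hypotheses on v' only involve inner products of combinations, hence its
     Gram matrix, so they hold for u and u carries its own hard instance. *)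
  rewrite /Rn' enorm_sqr -dotu -enorm_sqr; apply: worst_case_ge.
  + exact: tab.
  + move=> j; rewrite /enorm -(lincomb_delta j u) dotu lincomb_delta.
    exact: v'1.
  + move=> i j; rewrite -(lincomb_delta (l' i) u) -(lincomb_delta j u).
    rewrite -lincombB dotu lincombB !lincomb_delta; exact: zB'.
  + by move=> i; rewrite -(lincomb_delta (l' i) u) dotu lincomb_delta; apply: zv'.
  + by rewrite enorm_sqr dotu -enorm_sqr.
Qed.
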